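(* Let $g\in\mathbb{N}$, $g\geq 1$, be fixed. For each $n\in\mathbb{N}$, let $\vec{Z}_n$ be an acyclic orientation of the $n$-th Zykov graph $Z_n$ such that there is at most one directed path between any two of its vertices. Then: (1) for every $n$, the graph $L^g(\vec{Z}_n)$ can be acyclically oriented such that between any two vertices there exists at most one directed path; (2) $\chi(L^g(\vec{Z}_n))\to\infty$ as $n\to\infty$; (3) for every $n$, the graph $L^g(\vec{Z}_n)$ has odd-girth greater than or equal to $2g+3$.
   Context: All graphs are finite and simple; digraphs are orientations of simple graphs. ''At most one directed path between any two vertices'' means: for all distinct vertices $u,v$ there is at most one directed path from $u$ to $v$. A digraph is acyclic if it has no directed cycle. The line digraph $\vec{L}(\vec{G})$ of a digraph $\vec{G}$ has as vertices the arcs of $\vec{G}$, with an arc from $ab$ to $cd$ iff $b=c$. If $\vec{G}$ is acyclic then so is $\vec{L}(\vec{G})$, and one defines iterated line digraphs $\vec{L}^0(\vec{G})=\vec{G}$, $\vec{L}^g(\vec{G})=\vec{L}(\vec{L}^{g-1}(\vec{G}))$ for $g\geq 1$; $L^g(\vec{G})$ denotes the underlying undirected graph of $\vec{L}^g(\vec{G})$. Zykov graphs: $Z_1$ is a single vertex; for $n\geq 1$, $Z_{n+1}$ is obtained from the disjoint union of $Z_1,\dots,Z_n$ by adding, for each tuple $(x_1,\dots,x_n)\in V(Z_1)\times\cdots\times V(Z_n)$, a new vertex adjacent exactly to $x_1,\dots,x_n$. It is known that each $Z_n$ admits an acyclic orientation with at most one directed path between any two vertices. $\chi$ is the chromatic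 number. The odd-girth of a graph is the number of edges in a shortest odd cycle; a graph with no odd cycle is regarded as having infinite odd-girth. *)

(* Defs.v *)
From Stdlib Require Import FunctionalExtensionality.
From HB Require Import structures.
From mathcomp Require Import all_boot.
Set Implicit Arguments.
Unset Strict Implicit.
Unset Printing Implicit Defensive.

Record sgraph := SGraph {
  svert :> finType;
  adj : rel svert;
  adj_sym : symmetric adj;
  adj_irr : irreflexive adj }.

(* Asymmetry excludes loops and 2-cycles: these are exactly the orientations
   of simple graphs. *)
Record digraph := Digraph {
  dvert :> finType;
  arc : rel dvert;
  arc_asym : forall x y, arc x y -> ~~ arc y x }.

Record orientation (G : sgraph) := Orientation {
  oarc : rel G;
  oarc_asym : forall x y, oarc x y -> ~~ oarc y x;
  oarc_adj : forall x y, adj x y = oarc x y || oarc y x }.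

Definition digraph_of (G : sgraph) (O : orientation G) : digraph :=
  Digraph (@oarc_asym G O).
Coercion digraph_of : orientation >-> digraph.

Section Digraphs.
Variable D : digraph.

Definition acyclic := forall c : seq D, ucycle (@arc D) c -> c = [::].

(* The path has vertices u :: p, in this order. *)
Definition dipath (u v : D) (p : seq D) :=
  [&& path (@arc D) u p, uniq (u :: p) & last u p == v].

Definition unique_paths := forall (u v : D) (p q : seq D),
  u != v -> dipath u v p -> dipath u v q -> p = q.

Lemma underlying_sym : symmetric (fun x y : D => arc x y || arc y x).
Proof. by move=> x y; rewrite orbC. Qed.

Lemma underlying_irr : irreflexive (fun x y : D => arc x y || arc y x).
Proof.
by move=> x; rewrite orbb; apply/negP => axx; have := arc_asym axx; rewrite axx.
Qed.

Definition underlying : sgraph := SGraph underlying_sym underlying_irr.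

Definition line_vert : finType := {e : D * D | arc e.1 e.2}.

Definition line_arc (e f : line_vert) := (val e).2 == (val f).1.

Lemma line_arc_asym e f : line_arc e f -> ~~ line_arc f e.
Proof.
case: e f => [[a b] /= ab] [[c d] /= cd]; rewrite /line_arc /= => /eqP bc.
apply/eqP=> da; move: (arc_asym ab); rewrite bc -da.
by rewrite cd.
Qed.

Definition line_digraph : digraph := Digraph line_arc_asym.

End Digraphs.

Definition iter_line (g : nat) (D : digraph) : digraph := iter g line_digraph D.

Section ZykovStep.
Variables (n : nat) (F : 'I_n -> sgraph).

(* Disjoint union of the F i, plus one new vertex per tuple (x_i)_i. *)
Definition zykov_vert : finType :=
  ({i : 'I_n & F i} + {dffun forall i : 'I_n, F i})%type.

Definition zykov_adj (u v : zykov_vert) : bool :=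
  match u, v with
  | inl x, inl y => (tag x == tag y) && adj (tagged x) (tagged_as x y)
  | inl x, inr f => f (tag x) == tagged x
  | inr f, inl x => f (tag x) == tagged x
  | inr _, inr _ => false
  end.

Lemma zykov_adj_sym : symmetric zykov_adj.
Proof.
move=> [[i x]|f] [[j y]|h] //=; case: eqVneq => //= ij.
by subst j; rewrite !tagged_asE adj_sym.
Qed.

Lemma zykov_adj_irr : irreflexive zykov_adj.
Proof. by move=> [[i x]|f] //=; rewrite eqxx tagged_asE adj_irr. Qed.

Definition zykov_step : sgraph := SGraph zykov_adj_sym zykov_adj_irr.

End ZykovStep.

Fixpoint zykov_upto (n : nat) : 'I_n -> sgraph :=
  match n with
  | 0 => fun i => False_rect _ (notF (ltn_ord i))
  | m.+1 => fun i =>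
      if unlift ord_max i is Some j then zykov_upto j
      else zykov_step (@zykov_upto m)
  end.

(* Indices are shifted by one: zykov n is Z_{n+1}. In particular zykov 0 is
   Z_1, whose only vertex is the empty tuple; zykovE is the defining recursion. *)
Definition zykov (n : nat) : sgraph := zykov_step (@zykov_upto n).

Lemma zykov_uptoE n (i : 'I_n) : zykov_upto i = zykov i.
Proof.
elim: n i => [[]//|n IHn] i /=; case: unliftP => [j ->|->] //.
by rewrite IHn lift_max.
Qed.

Lemma zykovE n : zykov n = zykov_step (fun i : 'I_n => zykov i).
Proof.
by congr zykov_step; apply: functional_extensionality => i; rewrite zykov_uptoE.
Qed.

Lemma card_zykov0 : #|zykov 0| = 1.
Proof.
rewrite card_sum card_tagged card_dep_ffun.
by rewrite !foldrE !big_map /= -enumT !enum_ord0 big_nil.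
Qed.

Section Invariants.
Variable G : sgraph.

Definition proper (k : nat) (c : {ffun G -> 'I_k}) :=
  [forall x, forall y, adj x y ==> (c x != c y)].

Definition colorable (k : nat) := [exists c : {ffun G -> 'I_k}, proper c].

Lemma colorable_card : exists k, colorable k.
Proof.
exists #|G|; apply/existsP; exists [ffun x => enum_rank x].
apply/forallP=> x; apply/forallP=> y; apply/implyP=> xy.
rewrite !ffunE (inj_eq enum_rank_inj).
by apply: contraTneq xy => ->; rewrite adj_irr.
Qed.

Definition chi : nat := ex_minn colorable_card.

Definition odd_cycle (c : seq G) :=
  [&& odd (size c), 2 < size c & ucycleb (@adj G) c].

Definition odd_cycle_length (l : nat) := [exists c : l.-tuple G, odd_cycle c].

(* None stands for infinity. A cycle has at most #|G| vertices, so the list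
   enumerates the lengths of all odd cycles in increasing order. *)
Definition odd_girth : option nat :=
  ohead [seq l <- iota 0 #|G|.+1 | odd_cycle_length l].

Lemma odd_girthP :
  match odd_girth with
  | Some l => (exists2 c, odd_cycle c & size c = l) /\
              (forall c, odd_cycle c -> l <= size c)
  | None => forall c, ~~ odd_cycle c
  end.
Proof.
have inL c : odd_cycle c ->
    size c \in [seq l <- iota 0 #|G|.+1 | odd_cycle_length l].
  move=> oc; rewrite mem_filter mem_iota /= add0n ltnS; apply/andP; split.
    by apply/existsP; exists (in_tuple c).
  by case/and3P: oc => _ _ /andP[_ /card_uniqP <-]; apply: max_card.
have: sorted ltn [seq l <- iota 0 #|G|.+1 | odd_cycle_length l].
  by apply: sorted_filter; [exact: ltn_trans | exact: iota_ltn_sorted].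
rewrite /odd_girth.
case defL: [seq l <- iota 0 #|G|.+1 | odd_cycle_length l] => [|l s] /=.
  by move=> _ c; apply/negP => /inL; rewrite defL.
move=> srt; split.
  have: l \in l :: s by rewrite mem_head.
  rewrite -defL mem_filter => /andP[/existsP[c oc] _].
  by exists c; rewrite ?size_tuple.
move=> c /inL; rewrite defL inE => /predU1P[->//|cs].
by apply: ltnW; apply: (allP (order_path_min ltn_trans srt)).
Qed.

End Invariants.

Definition le_inf (m : nat) (x : option nat) : bool :=
  if x is Some l then m <= l else true.

(* Main.v *)
From mathcomp Require Import all_boot.
Require Import Defs.

(** Every directed path of the line digraph of [D] traces a directed path of
    [D], so acyclicity and uniqueness of directed paths are inherited by line
    digraphs.  Colouring a vertex by the set of colours of its outgoing arcs turns
    a [k]-colouring of the line digraph into a [2 ^ k]-colouring of [D], and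
    [Z_n] needs [n] colours, so the chromatic numbers of the iterated line
    digraphs tend to infinity.  Finally, every edge [ef] of the line graph has a
    middle vertex in [D], the one shared by the arcs [e] and [f].  Along a closed
    walk, successive middle vertices are adjacent when the walk keeps its
    direction and equal when it turns.  The number of turns is even, and nonzero
    if [D] is acyclic; hence a closed walk of odd length [l] gives one of odd
    length at most [l - 2] in [D]. *)

(** * Acyclicity and unique directed paths in line digraphs *)

Section LineDigraph.
Variable D : digraph.

(** [acyclic] only concerns cycles without repeated vertices; shortening the path before the closing
    arc produces one. *)
Lemma acyclic_cycle (c : seq D) : acyclic D -> cycle (@arc D) c -> c = [::].
Proof.
move=> acD; case: c => // x p; rewrite /= rcons_path => /andP[xp lx].
move: lx; case/shortenP: xp => p' xp' Up' _ lx.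
suff: x :: p' = [::] by [].
by apply: acD; rewrite /ucycle /= rcons_path xp' lx.
Qed.

Lemma acyclic_path_uniq (x : D) (p : seq D) :
  acyclic D -> path (@arc D) x p -> uniq (x :: p).
Proof.
move=> acD; elim: p x => // y p IHp x xyp; rewrite cons_uniq.
have /andP[_ yp] := xyp; rewrite IHp // andbT; apply/negP => xin.
move: xyp; case/path.splitP: xin => p1 p2; rewrite cat_path => /andP[xp1 _].
by have := @acyclic_cycle (x :: p1) acD xp1.
Qed.

Lemma line_arc_heads (e f : line_digraph D) :
  arc e f -> arc (val e).2 (val f).2.
Proof. by move=> /eqP->; exact: (valP f). Qed.

Lemma line_acyclic : acyclic D -> acyclic (line_digraph D).
Proof.
move=> acD c /andP[cc _].
have /(acyclic_cycle _ acD): cycle (@arc D) [seq (val e).2 | e <- c].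
  by apply: homo_cycle cc; exact: line_arc_heads.
by case: c {cc}.
Qed.

Lemma line_path_heads (e : line_digraph D) (p : seq (line_digraph D)) :
  path (@arc _) e p -> path (@arc _) (val e).1 (map (fun f => (val f).2) (e :: p)).
Proof.
move=> ep; rewrite /= (valP e) /=.
by apply: homo_path ep; exact: line_arc_heads.
Qed.

(** Each arc after [e] starts at the head of its predecessor, so along the path its head alone
    determines it. *)
Lemma line_path_heads_inj (e : line_digraph D) (p q : seq (line_digraph D)) :
  path (@arc _) e p -> path (@arc _) e q ->
  [seq (val f).2 | f <- p] = [seq (val f).2 | f <- q] -> p = q.
Proof.
elim: p e q => [|f p IHp] e [|h q] //= /andP[/eqP ef fp] /andP[/eqP eh hq].
case=> fh pq; have fhE : f = h.
  by apply: val_inj; apply: injective_projections; rewrite // -ef -eh.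
by rewrite -fhE in hq *; rewrite (IHp f q).
Qed.

Lemma line_unique_paths :
  acyclic D -> unique_paths D -> unique_paths (line_digraph D).
Proof.
move=> acD upD e f p q _ /and3P[ep _ /eqP lp] /and3P[eq _ /eqP lq].
have Pp := line_path_heads _ _ ep; have Pq := line_path_heads _ _ eq.
have Up := acyclic_path_uniq _ _ acD Pp; have Uq := acyclic_path_uniq _ _ acD Pq.
have Lp : last (val e).1 (map (fun h => (val h).2) (e :: p)) = (val f).2.
  by rewrite /= (last_map (fun h => (val h).2)) lp.
have Lq : last (val e).1 (map (fun h => (val h).2) (e :: q)) = (val f).2.
  by rewrite /= (last_map (fun h => (val h).2)) lq.
apply: (line_path_heads_inj e) => //.
suff [//] : map (fun h => (val h).2) (e :: p) = map (fun h => (val h).2) (e :: q).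
apply: (upD (val e).1 (val f).2).
(* The traced path has at least one arc and repeats no vertex, so its ends differ. *)
- by apply: contraTneq Up => ef; rewrite cons_uniq ef -Lp /= mem_last.
- by rewrite /dipath Pp Up Lp eqxx.
- by rewrite /dipath Pq Uq Lq eqxx.
Qed.

End LineDigraph.

Lemma iter_line_acyclic (g : nat) (D : digraph) :
  acyclic D -> acyclic (iter_line g D).
Proof. by move=> acD; elim: g => //= g IHg; apply: line_acyclic. Qed.

Lemma iter_line_unique_paths (g : nat) (D : digraph) :
  acyclic D -> unique_paths D -> unique_paths (iter_line g D).
Proof.
move=> acD upD; elim: g => //= g IHg.
by apply: line_unique_paths => //; apply: iter_line_acyclic.
Qed.

(** * Colourings of line digraphs *)

Lemma colorableP (G : sgraph) (k : nat) :
  reflect (exists c : G -> 'I_k, forall x y, adj x y -> c x != c y)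
          (colorable G k).
Proof.
apply: (iffP existsP) => [[c /forallP pc]|[c pc]].
  by exists c => x y xy; have /forallP/(_ y)/implyP/(_ xy) := pc x.
exists [ffun x => c x]; apply/forallP => x; apply/forallP => y.
by apply/implyP => xy; rewrite !ffunE pc.
Qed.

Lemma colorable_finType (G : sgraph) (T : finType) (c : G -> T) :
  (forall x y, adj x y -> c x != c y) -> colorable G #|T|.
Proof.
move=> pc; apply/colorableP; exists (fun x => enum_rank (c x)) => x y xy.
by rewrite (inj_eq enum_rank_inj) pc.
Qed.

Lemma line_colorable (D : digraph) (k : nat) :
  colorable (underlying (line_digraph D)) k -> colorable (underlying D) (2 ^ k).
Proof.
case/colorableP => c pc.
have -> : 2 ^ k = #|{set 'I_k}| by rewrite -cardsT -powersetT card_powerset cardsT card_ord.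
pose C (v : D) := [set c e | e : line_vert D & (val e).1 == v].
have arcC x y : arc x y -> C x != C y.
  move=> xy; pose e : line_vert D := exist _ (x, y) xy.
  (* If the colour of [e] were also in [C y], an arc leaving [y], hence adjacent to [e], would share
     it. *)
  apply/eqP => Cxy; have: c e \in C x by apply/imsetP; exists e; rewrite ?inE /=.
  rewrite Cxy => /imsetP[f]; rewrite inE => /eqP fy cef.
  suff /pc : @adj (underlying (line_digraph D)) e f by rewrite cef eqxx.
  by apply/orP; left; apply/eqP.
apply: (@colorable_finType (underlying D) {set 'I_k} C) => x y /orP[] /arcC //.
by rewrite eq_sym.
Qed.

Lemma iter_line_colorable (g : nat) (D : digraph) (k : nat) :
  colorable (underlying (iter_line g D)) k ->
  colorable (underlying D) (iter g (expn 2) k).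
Proof.
elim: g k => //= g IHg k /line_colorable/IHg.
by rewrite -iterSr.
Qed.

Lemma iter_expn2_mono (g : nat) : {homo iter g (expn 2) : k l / k <= l}.
Proof. by elim: g => //= g IHg k l /IHg; rewrite leq_exp2l. Qed.

(** * Colours needed by Zykov graphs *)

(** Greedy choice: the last set is too large to be exhausted by the representatives already
    chosen. *)
Lemma distinct_representatives (T : finType) (n : nat) (A : 'I_n -> {set T}) :
  (forall i : 'I_n, i < #|A i|) ->
  exists2 h : 'I_n -> T, injective h & forall i, h i \in A i.
Proof.
elim: n A => [|n IHn] A cA; first by exists (fun i : 'I_0 => False_rect T (notF (ltn_ord i))) => -[].
have [|h hI hA] := IHn (fun i => A (lift ord_max i)).
  by move=> i; have := cA (lift ord_max i); rewrite lift_max.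
have [x xA xh] : exists2 x, x \in A ord_max & x \notin codom h.
  apply/subsetPn; apply: contraTN (cA ord_max) => /subset_leq_card.
  by rewrite card_codom // card_ord -leqNgt.
exists (fun i => if unlift ord_max i is Some j then h j else x).
  move=> i j; case: unliftP => [i' ->|->]; case: unliftP => [j' ->|->] //.
  - by move/hI->.
  - by move=> hx; rewrite -hx codom_f in xh.
  - by move=> hx; rewrite hx codom_f in xh.
by move=> i; case: unliftP => [j ->|->].
Qed.

(** One can pick distinct colours [h i], each used in [F i]; the new vertex joined to vertices of
    these colours needs a further one. *)
Lemma zykov_step_colors (n : nat) (F : 'I_n -> sgraph) (T : finType)
    (c : zykov_step F -> T) :
  (forall (i : 'I_n) (d : F i -> T),
     (forall x y, adj x y -> d x != d y) -> i < #|codom d|) ->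
  (forall x y, adj x y -> c x != c y) -> n < #|codom c|.
Proof.
move=> colF pc; pose d i (x : F i) := c (inl (Tagged (fun i => F i : Type) x)).
have [i|h hI hA] := distinct_representatives _ _ (fun i => [set t in codom (d i)]).
  rewrite cardsE; apply: colF => x y xy; apply: pc.
  by rewrite /= eqxx tagged_asE.
have /fin_all_exists[f fh] : forall i, exists x : F i, h i = d i x.
  by move=> i; have := hA i; rewrite inE => /codomP.
pose u : zykov_step F := inr [ffun i => f i].
have hu : c u \notin codom h.
  apply/codomP => -[i]; rewrite fh => /eqP; apply/negP; apply: pc.
  by rewrite /= ffunE.
have ch : #|codom h| = n by rewrite card_codom // card_ord.
suff: #|codom h| < #|codom c| by rewrite ch.
apply: proper_card; apply/properP; split.
  by apply/subsetP => _ /codomP[i ->]; rewrite fh; apply: codom_f.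
by exists (c u); rewrite ?codom_f.
Qed.

Lemma zykov_colors (n : nat) (T : finType) (c : zykov n -> T) :
  (forall x y, adj x y -> c x != c y) -> n < #|codom c|.
Proof.
elim/ltn_ind: n T c => n IHn T; rewrite zykovE => c.
by apply: zykov_step_colors => i d; apply: IHn.
Qed.

Lemma zykov_colorable (n k : nat) : colorable (zykov n) k -> n < k.
Proof.
case/colorableP => c /zykov_colors/leq_trans; apply.
by rewrite -[leqRHS]card_ord max_card.
Qed.

Lemma chi_colorable (G : sgraph) : colorable G (chi G).
Proof. by rewrite /chi; case: ex_minnP. Qed.

Lemma orientation_colorable (G : sgraph) (O : orientation G) (k : nat) :
  colorable (underlying O) k -> colorable G k.
Proof.
case/colorableP => c pc; apply/colorableP; exists c => x y xy.
by apply: pc; rewrite /= -oarc_adj.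
Qed.

(** * Odd closed walks *)

Section OddWalks.

(** Closed walks replace cycles because middle vertices may repeat; [size p] counts the edges. *)
Definition odd_walks_ge (G : sgraph) (l : nat) :=
  forall (x : G) (p : seq G),
    path (@adj _) x p -> last x p = x -> odd (size p) -> l <= size p.

Lemma odd_walks_ge3 (G : sgraph) : odd_walks_ge G 3.
Proof. by move=> x [|y [|z [|t p]]] //= /andP[+ _] yx; rewrite yx adj_irr. Qed.

Lemma odd_walks_girth (G : sgraph) (l : nat) :
  odd_walks_ge G l -> le_inf l (odd_girth G).
Proof.
move=> Gl; have := odd_girthP G; case: odd_girth => //= _ [[c oc <-] _].
case/and3P: oc => co c2 /andP[]; case: c c2 co => // x p _ /= po xp _.
by have := Gl x _ xp; rewrite last_rcons size_rcons; apply.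
Qed.

Variable D : digraph.

Definition darc (d : bool) (e f : line_digraph D) := if d then arc e f else arc f e.

(* A walk leaves [e] through [endpt d e] when it steps in direction [d], and
   enters the next arc [f] through [endpt (~~ d) f], the same vertex of [D]. *)
Definition endpt (d : bool) (e : line_digraph D) := if d then (val e).2 else (val e).1.

Lemma darc_endpt d e f : darc d e f -> endpt d e = endpt (~~ d) f.
Proof. by case: d => /eqP. Qed.

Lemma endpt_adj d (e : line_digraph D) :
  @adj (underlying D) (endpt (~~ d) e) (endpt d e).
Proof. by have := valP e; case: d => /= ->; rewrite ?orbT. Qed.

(** Keeping the direction traverses the arc [e]; turning leaves [e] by the end at which it was
    entered. *)
Lemma darc_step d d1 e f : darc d1 e f ->
  if d1 == d
  then is_true (@adj (underlying D) (endpt (~~ d) e) (endpt (~~ d1) f))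
  else endpt (~~ d) e = endpt (~~ d1) f.
Proof.
move=> /darc_endpt; case: eqVneq => [->|nd] <-; first exact: endpt_adj.
by congr endpt; case: d d1 nd => [] [].
Qed.

(* [d] is the direction in which the walk enters [e], [d'] that of its last step,
   and [t] is the number of turns. *)
Lemma middle_walk e f p d d' :
  path (@adj (underlying (line_digraph D))) e p -> darc d' (last e p) f ->
  exists q t,
    [/\ path (@adj (underlying D)) (endpt (~~ d) e) q,
        last (endpt (~~ d) e) q = endpt (~~ d') f,
        size q + t = (size p).+1, odd t = (d != d')
      & t = 0 -> path (darc d) e (rcons p f)].
Proof.
elim: p e d => [|h p IHp] e d /=.
  move=> _ ef; have := darc_step d _ _ _ ef; case: eqVneq => [dd|nd] st.
    rewrite dd in ef st *; exists [:: endpt (~~ d) f], 0.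
    by split=> // [|_]; apply/andP.
  by exists [::], 1.
move=> /andP[eh hp] pf.
have [d1 dh] : exists d1, darc d1 e h.
  by case/orP: eh; [exists true | exists false].
have [q [t [qp ql sz ot tz]]] := IHp h d1 hp pf.
have := darc_step d _ _ _ dh; case: eqVneq => [dd|nd] st.
  exists (endpt (~~ d1) h :: q), t; split=> //; first by apply/andP.
  - by rewrite /= addSn sz.
  - by rewrite -dd.
  - by move/tz=> hpf; apply/andP; rewrite -dd.
exists q, t.+1; rewrite st; split=> //.
- by rewrite /= addnS sz.
(* The turn flips the direction, hence the parity of the count. *)
- by rewrite /= ot; case: d d1 d' nd {IHp dh pf ql ot tz st qp} => [] [] [].
Qed.

Lemma line_odd_walks (l : nat) :
  acyclic D -> odd_walks_ge (underlying D) l ->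
  odd_walks_ge (underlying (line_digraph D)) l.+2.
Proof.
move=> acD Dl e p; case/lastP: p => // p f.
rewrite rcons_path last_rcons size_rcons => /andP[ep pf] fe podd.
rewrite {f}fe in pf.
have [d dpf] : exists d, darc d (last e p) e.
  by case/orP: pf; [exists true | exists false].
(* Using [d] as both initial and final direction makes the middle walk closed and [t] even. *)
have [q [t [qp ql sz]]] := middle_walk e e p d d ep dpf.
rewrite eqxx => ot tz.
have t2 : 2 <= t.
  case: t sz ot tz => [|[|t]] // _ _ /(_ erefl) cyc.
  have acL := line_acyclic D acD.
  case: d {dpf qp ql} cyc => cyc; first by have := acyclic_cycle _ (e :: p) acL cyc.
  (* Here [d = false]: the turn-free walk runs against the arcs, so it is reversed. *)
  have := acyclic_cycle _ (rev (e :: p)) acL.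
  by rewrite rev_cycle => /(_ cyc)/(congr1 size); rewrite size_rev.
have qodd : odd (size q).
  by move: podd; rewrite -sz oddD ot addbF.
by rewrite -sz -addn2 leq_add // (Dl _ _ qp ql qodd).
Qed.

End OddWalks.

Lemma iter_line_odd_walks (g : nat) (D : digraph) :
  acyclic D -> odd_walks_ge (underlying (iter_line g D)) (2 * g + 3).
Proof.
move=> acD; elim: g => [|g IHg]; first exact: odd_walks_ge3.
rewrite mulnS -addnA add2n.
by apply: line_odd_walks IHg; apply: iter_line_acyclic.
Qed.

Theorem theorem20 (g : nat) (hg : 1 <= g)
    (Z : forall n : nat, orientation (zykov n))
    (Zacyclic : forall n : nat, acyclic (Z n))
    (Zpaths : forall n : nat, unique_paths (Z n)) :
  [/\ forall n : nat,
        exists O : orientation (underlying (iter_line g (Z n))),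
          acyclic O /\ unique_paths O,
      forall k : nat, exists N : nat, forall n : nat,
        N <= n -> k <= chi (underlying (iter_line g (Z n)))
    & forall n : nat,
        le_inf (2 * g + 3) (odd_girth (underlying (iter_line g (Z n))))].
Proof.
split=> [n|k|n].
- pose D := iter_line g (Z n).
  exists (@Orientation (underlying D) (@arc D) (@arc_asym D) (fun _ _ => erefl)).
  by split; [exact: iter_line_acyclic | exact: iter_line_unique_paths].
(* If fewer than [k] colours sufficed, [zykov n] would be colourable with at most
   [iter g (expn 2) k] colours, forcing [n] below this number. *)
- exists (iter g (expn 2) k) => n; apply: contraTT; rewrite -!ltnNge => chik.
  apply: leq_trans (iter_expn2_mono g _ _ (ltnW chik)).
  apply: zykov_colorable; apply: (@orientation_colorable _ (Z n)).
  exact: iter_line_colorable (chi_colorable _).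
- exact: odd_walks_girth (iter_line_odd_walks _ _ (Zacyclic n)).
Qed.
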